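(* Let $R$ be a commutative ring with $1$ and $M$ an $R$-module. The map $p:M\to P^2_R(M)$, $x\mapsto p(x)$, is universal $R$-quadratic; that is, $p$ is $R$-quadratic and for any $R$-module $N$, precomposition by $p$ induces a binatural isomorphism $$\mathrm{Hom}_R(P^2_R(M),N)\to R\text{-}\mathrm{Quad}(M,N).$$
   Context: For $R$-modules $M,N$, a map $f:M\to N$ is $R$-quadratic if (1) its cross-effect $d_f:M\times M\to N$, $d_f(x,y)=f(x+y)-f(x)-f(y)$, is $R$-bilinear, and (2) for each $r\in R$ the map $f_{[r]}:M\to N$, $f_{[r]}(x)=f(rx)-r^2f(x)$, is $R$-linear. $R\text{-}\mathrm{Quad}(M,N)$ denotes the $R$-module of $R$-quadratic maps $M\to N$ (pointwise operations). $P^2_R(M)$ is the $R$-module generated by elements $p(x)$, $x\in M$, subject to the relations, for $x,y,z\in M$, $r,s\in R$: $p(x+y+z)-p(x+y)-p(y+z)-p(x+z)+p(x)+p(y)+p(z)=0$; $p(rx+sy)-p(rx)-p(sy)-rs\,p(x+y)+rs\,p(x)+rs\,p(y)=0$; $p(rsx)-r^2p(sx)-s\,p(rx)+r^2s\,p(x)=0$. *)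

(* Defs.v *)
From HB Require Import structures.
From mathcomp Require Import all_boot all_order all_algebra.
From mathcomp Require Import finmap all_classical.

Set Implicit Arguments.
Unset Strict Implicit.
Unset Printing Implicit Defensive.

Import GRing.Theory.
Local Open Scope ring_scope.
Local Open Scope quotient_scope.

(* Rings are comPzRingType: the zero ring is allowed. *)

Section HomModule.
Variables (R : comPzRingType) (U V : lmodType R).
Implicit Types f g h : {linear U -> V}.

HB.instance Definition _ := gen_eqMixin {linear U -> V}.
HB.instance Definition _ := gen_choiceMixin {linear U -> V}.

Lemma linear_ext f g : f =1 g -> f = g.
Proof.
case: f g => [f [[f1] [f2]]] [g [[g1] [g2]]] /= fg.
have {}fg : f = g by apply/funext.
rewrite {}fg in f1 f2 *.
by rewrite (Prop_irrelevance f1 g1) (Prop_irrelevance f2 g2).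
Qed.

Definition hom_zero : {linear U -> V} := \0.
Definition hom_opp f : {linear U -> V} := \- f.
Definition hom_add f g : {linear U -> V} := f \+ g.

Fact hom_addA : associative hom_add.
Proof. by move=> f g h; apply: linear_ext => x /=; rewrite addrA. Qed.
Fact hom_addC : commutative hom_add.
Proof. by move=> f g; apply: linear_ext => x /=; rewrite addrC. Qed.
Fact hom_add0 : left_id hom_zero hom_add.
Proof. by move=> f; apply: linear_ext => x /=; rewrite add0r. Qed.
Fact hom_addN : left_inverse hom_zero hom_opp hom_add.
Proof. by move=> f; apply: linear_ext => x /=; rewrite addNr. Qed.

HB.instance Definition _ := GRing.isZmodule.Build {linear U -> V}
  hom_addA hom_addC hom_add0 hom_addN.

Fact hom_scale_is_linear (a : R) f : linear (a \*: f).
Proof. by move=> b x y /=; rewrite linearP scalerDr !scalerA mulrC. Qed.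
HB.instance Definition _ (a : R) f :=
  GRing.isLinear.Build R U V *:%R (a \*: f) (hom_scale_is_linear a f).
Definition hom_scale (a : R) f : {linear U -> V} := a \*: f.

Fact hom_scaleA a b f : hom_scale a (hom_scale b f) = hom_scale (a * b) f.
Proof. by apply: linear_ext => x /=; rewrite scalerA. Qed.
Fact hom_scale1 : left_id 1 hom_scale.
Proof. by move=> f; apply: linear_ext => x /=; rewrite scale1r. Qed.
Fact hom_scaleDr : right_distributive hom_scale +%R.
Proof. by move=> a f g; apply: linear_ext => x /=; rewrite scalerDr. Qed.
Fact hom_scaleDl f : {morph hom_scale^~ f : a b / a + b}.
Proof. by move=> a b; apply: linear_ext => x /=; rewrite scalerDl. Qed.

HB.instance Definition _ := GRing.Zmodule_isLmodule.Build R {linear U -> V}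
  hom_scaleA hom_scale1 hom_scaleDr hom_scaleDl.

End HomModule.

Section Quadratic.
Variables (R : comPzRingType) (M N : lmodType R).
Implicit Types f : M -> N.

Definition cross_effect f (x y : M) : N := f (x + y) - f x - f y.

Definition homog_defect f (r : R) (x : M) : N := f (r *: x) - r ^+ 2 *: f x.

(* The library's bilinear_for requires a nontrivial ring; this is its
   unfolding over an arbitrary one. *)
Definition is_bilinear (d : M -> M -> N) : Prop :=
  (forall y, linear (d^~ y)) /\ (forall x, linear (d x)).

Definition is_quadratic f : Prop :=
  is_bilinear (cross_effect f) /\ forall r : R, linear (homog_defect f r).

Definition quadratic_pred : {pred M -> N} := fun f => `[< is_quadratic f >].

Lemma quadratic_predP f : reflect (is_quadratic f) (f \in quadratic_pred).
Proof. exact: asboolP. Qed.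

Fact quadratic_submod_closed : submod_closed quadratic_pred.
Proof.
split=> [|a f g /quadratic_predP [[fl fr] fh] /quadratic_predP [[gl gr] gh]].
  apply/quadratic_predP; split; [split=> z|move=> r] => a x y;
  by rewrite /cross_effect /homog_defect /GRing.zero /= !(subr0, scaler0, addr0).
have dE x y : cross_effect (a *: f + g) x y
    = a *: cross_effect f x y + cross_effect g x y.
  rewrite /cross_effect !addrfctE !scalrfctE !scalerBr !opprD.
  by rewrite [X in X + _]addrACA [LHS]addrACA.
have hE r x : homog_defect (a *: f + g) r x
    = a *: homog_defect f r x + homog_defect g r x.
  rewrite /homog_defect !addrfctE !scalrfctE scalerBr scalerDr !scalerA.
  by rewrite [r ^+ 2 * a]mulrC opprD addrACA.
have comb (F G H : M -> N) : (forall x, H x = a *: F x + G x) ->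
    linear F -> linear G -> linear H.
  move=> HE lF lG b x y; rewrite !HE lF lG !scalerDr !scalerA [a * b]mulrC.
  by rewrite addrACA.
apply/quadratic_predP; split; [split=> z|move=> r].
- exact: (comb _ _ _ (dE^~ z) (fl z) (gl z)).
- exact: (comb _ _ _ (dE z) (fr z) (gr z)).
- exact: (comb _ _ _ (hE r) (fh r) (gh r)).
Qed.

HB.instance Definition _ :=
  GRing.isSubmodClosed.Build R (M -> N) quadratic_pred quadratic_submod_closed.

Record Quad : Type := MkQuad {
  quad_fun :> M -> N;
  _ : quad_fun \in quadratic_pred
}.

HB.instance Definition _ := [isSub for quad_fun].
HB.instance Definition _ := [Choice of Quad by <:].
HB.instance Definition _ := [SubChoice_isSubLmodule of Quad by <:].

Lemma quadP (q : Quad) : is_quadratic q.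
Proof. exact/quadratic_predP/(valP q). Qed.

End Quadratic.

Section QuadFunctor.
Variables (R : comPzRingType) (M M' N N' : lmodType R).
Variables (f : {linear M' -> M}) (g : {linear N -> N'}).

Fact quad_comp_subproof (q : Quad M N) :
  (fun x => g (q (f x))) \in @quadratic_pred R M' N'.
Proof.
have [[ql qr] qh] := quadP q; apply/quadratic_predP.
have dE x y : cross_effect (fun x => g (q (f x))) x y
    = g (cross_effect q (f x) (f y)).
  by rewrite /cross_effect !linearB !linearD.
have hE r x : homog_defect (fun x => g (q (f x))) r x
    = g (homog_defect q r (f x)).
  by rewrite /homog_defect linearB !linearZ.
by split; [split=> z|move=> r] => a x y;
  rewrite ?dE ?hE linearP ?ql ?qr ?qh linearP.
Qed.

Definition quad_map (q : Quad M N) : Quad M' N' := MkQuad (quad_comp_subproof q).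

End QuadFunctor.

Section FreeModule.
Variables (R : comPzRingType) (X : choiceType).

Definition finsupp_pred : {pred X -> R^o} :=
  fun u => `[< finite_set [set x | u x != 0] >].

Fact finsupp_submod_closed : submod_closed finsupp_pred.
Proof.
split=> [|a u v /asboolP fu /asboolP fv]; apply/asboolP.
  by apply: (sub_finite_set _ (finite_set0 X)) => x /=; rewrite eqxx.
have fuv : finite_set ([set x | u x != 0] `|` [set x | v x != 0]).
  by rewrite finite_setU.
apply: sub_finite_set fuv => x /=; rewrite addrfctE scalrfctE => nz.
have [u0|] := eqVneq (u x) 0; last by left.
by right; move: nz; rewrite u0 scaler0 add0r.
Qed.

HB.instance Definition _ :=
  GRing.isSubmodClosed.Build R (X -> R^o) finsupp_pred finsupp_submod_closed.

Record freemod : Type := MkFreemod {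
  freemod_coef :> X -> R^o;
  _ : freemod_coef \in finsupp_pred
}.

HB.instance Definition _ := [isSub for freemod_coef].
HB.instance Definition _ := [Choice of freemod by <:].
HB.instance Definition _ := [SubChoice_isSubLmodule of freemod by <:].

Fact free_gen_subproof (x : X) : (fun y => (y == x)%:R) \in finsupp_pred.
Proof.
apply/asboolP; apply: (sub_finite_set _ (finite_set1 x)) => y /=.
by case: (eqVneq y x) => // _; rewrite eqxx.
Qed.

Definition free_gen (x : X) : freemod := MkFreemod (free_gen_subproof x).

Variable N : lmodType R.

Definition free_lift (g : X -> N) (u : freemod) : N :=
  \sum_(x \in [set: X]) (u x : R) *: g x.

Lemma free_liftE (g : X -> N) (u : freemod) (D : {fset X}) :
  (forall x, x \notin D -> u x = 0) ->
  free_lift g u = \sum_(x <- D) (u x : R) *: g x.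
Proof. by move=> uD; apply: fsbigTE => x /uD ->; rewrite scale0r. Qed.

Lemma freemod_supp (u : freemod) :
  exists D : {fset X}, forall x, x \notin D -> u x = 0.
Proof.
have /asboolP fu := valP u.
exists (fset_set [set x | u x != 0]) => x.
rewrite in_fset_set // => /negP nD; apply/eqP/negPn/negP => nz.
by apply: nD; apply: mem_set.
Qed.

Fact free_lift_is_linear (g : X -> N) : linear (free_lift g).
Proof.
move=> a u v; have [Du uD] := freemod_supp u; have [Dv vD] := freemod_supp v.
have suppD (w : freemod) (D D' : {fset X}) : (forall x, x \notin D -> w x = 0) ->
    {subset D <= D'} -> forall x, x \notin D' -> w x = 0.
  by move=> wD DD' x xD'; apply: wD; apply: contraNN xD' => /DD'.
have uE := suppD u Du (Du `|` Dv)%fset uD (fun x => @fsubsetP _ _ _ (fsubsetUl _ _) x).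
have vE := suppD v Dv (Du `|` Dv)%fset vD (fun x => @fsubsetP _ _ _ (fsubsetUr _ _) x).
have cE x : (a *: u + v : freemod) x = a * u x + v x by [].
rewrite (free_liftE g uE) (free_liftE g vE) (@free_liftE _ _ (Du `|` Dv)%fset).
  rewrite scaler_sumr -big_split; apply: eq_bigr => x _.
  by rewrite cE scalerDl scalerA.
by move=> x xD; rewrite cE uE // vE // mulr0 addr0.
Qed.

HB.instance Definition _ (g : X -> N) :=
  GRing.isLinear.Build R freemod N *:%R (free_lift g) (free_lift_is_linear g).

Lemma free_lift_gen (g : X -> N) x : free_lift g (free_gen x) = g x.
Proof.
rewrite (@free_liftE _ _ [fset x]%fset) => [|y]; last first.
  by rewrite inE /= => /negPf ->.
by rewrite big_seq_fset1 /= eqxx scale1r.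
Qed.

End FreeModule.

Arguments free_gen R {X} x.

Lemma free_lift_id (R : comPzRingType) (X : choiceType) (u : freemod R X) :
  free_lift (free_gen R) u = u.
Proof.
have [D uD] := freemod_supp u; rewrite (free_liftE _ uD); apply: val_inj.
rewrite raddf_sum; apply/funext => y; rewrite fct_sumE.
transitivity (\sum_(x <- D) (u x : R) * (y == x)%:R); first exact: eq_bigr.
have [yD|yD] := boolP (y \in D); last first.
  rewrite [RHS]uD // big_seq big1 // => x xD.
  by case: eqVneq yD => [->|_ _]; rewrite ?xD // mulr0.
rewrite (bigD1_seq y) ?fset_uniq //= eqxx mulr1.
by rewrite big1 ?addr0 // => x xy; rewrite eq_sym (negPf xy) mulr0.
Qed.

(* The submodule spanned by A, as the intersection of the submodules containing it. *)
Section Span.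
Variables (R : pzRingType) (V : lmodType R) (A : set V).

Definition span_pred : {pred V} := fun v =>
  `[< forall S : {pred V},
        submod_closed S -> (forall a, A a -> a \in S) -> v \in S >].

Fact span_submod_closed : submod_closed span_pred.
Proof.
split=> [|a u v /asboolP su /asboolP sv]; apply/asboolP => S Scl AS.
  by case: Scl.
by have [_ Slin] := Scl; apply: Slin; [exact: su | exact: sv].
Qed.

HB.instance Definition _ :=
  GRing.isSubmodClosed.Build R V span_pred span_submod_closed.

End Span.

Section QuotientModule.
Variables (R : pzRingType) (V : lmodType R) (A : set V).

Definition quotmod : Type := {ideal_quot (span_pred A)}.
HB.instance Definition _ := Quotient.on quotmod.
HB.instance Definition _ := GRing.Zmodule.on quotmod.

Definition quotmod_pi (v : V) : quotmod := \pi_quotmod v.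

Lemma quotmod_piD u v : quotmod_pi (u + v) = quotmod_pi u + quotmod_pi v.
Proof. by rewrite /quotmod_pi piE. Qed.

Lemma quotmod_piP u v : (quotmod_pi u == quotmod_pi v) = (u - v \in span_pred A).
Proof. by rewrite Quotient.idealrBE. Qed.

Lemma quotmod_reprK (q : quotmod) : quotmod_pi (repr q) = q.
Proof. exact: reprK. Qed.

Definition quot_scale (a : R) (q : quotmod) : quotmod := quotmod_pi (a *: repr q).

Lemma pi_quot_scale a v : quot_scale a (quotmod_pi v) = quotmod_pi (a *: v).
Proof.
apply/eqP; rewrite quotmod_piP -scalerBr rpredZ // -quotmod_piP.
by rewrite quotmod_reprK.
Qed.

Fact quot_scaleA a b q : quot_scale a (quot_scale b q) = quot_scale (a * b) q.
Proof. by rewrite -[q]quotmod_reprK !pi_quot_scale scalerA. Qed.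
Fact quot_scale1 : left_id 1 quot_scale.
Proof. by move=> q; rewrite -[q]quotmod_reprK !pi_quot_scale scale1r. Qed.
Fact quot_scaleDr : right_distributive quot_scale +%R.
Proof.
move=> a p q; rewrite -[p]quotmod_reprK -[q]quotmod_reprK -quotmod_piD.
by rewrite !pi_quot_scale scalerDr quotmod_piD.
Qed.
Fact quot_scaleDl q : {morph quot_scale^~ q : a b / a + b}.
Proof.
move=> a b; rewrite -[q]quotmod_reprK !pi_quot_scale scalerDl.
exact: quotmod_piD.
Qed.

HB.instance Definition _ := GRing.Zmodule_isLmodule.Build R quotmod
  quot_scaleA quot_scale1 quot_scaleDr quot_scaleDl.

Fact quotmod_pi_is_linear : linear quotmod_pi.
Proof. by move=> a u v; rewrite quotmod_piD -pi_quot_scale. Qed.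
HB.instance Definition _ :=
  GRing.isLinear.Build R V quotmod *:%R quotmod_pi quotmod_pi_is_linear.

Variables (N : lmodType R) (g : {linear V -> N}).

Definition quotmod_lift (q : quotmod) : N := g (repr q).

Hypothesis gA : forall a, A a -> g a = 0.

Lemma quotmod_lift_pi v : quotmod_lift (quotmod_pi v) = g v.
Proof.
apply/eqP; rewrite -subr_eq0 -linearB.
have /eqP : quotmod_pi (repr (quotmod_pi v)) = quotmod_pi v.
  exact: quotmod_reprK.
rewrite quotmod_piP => /asboolP /(_ [pred u | g u == 0]) sg; apply: sg => [|a].
  split=> [|a u w]; rewrite !inE ?linear0 // => /eqP gu /eqP gw.
  by rewrite linearP gu gw scaler0 addr0.
by rewrite inE => /gA ->.
Qed.

Fact quotmod_lift_is_linear : linear quotmod_lift.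
Proof.
move=> a p q; rewrite -[p]quotmod_reprK -[q]quotmod_reprK -linearP.
by rewrite !quotmod_lift_pi linearP.
Qed.

End QuotientModule.

Section P2.
Variables (R : comPzRingType) (M : lmodType R).

Local Notation "[ x ]" := (free_gen R (x : M)) (at level 0, x at level 99).

(* The left-hand sides of the three families of relations. *)
Inductive P2_relator : set (freemod R M) :=
| P2_relator_add x y z : P2_relator
    ([x + y + z] - [x + y] - [y + z] - [x + z] + [x] + [y] + [z])
| P2_relator_cross (r s : R) x y : P2_relator
    ([r *: x + s *: y] - [r *: x] - [s *: y]
      - (r * s) *: [x + y] + (r * s) *: [x] + (r * s) *: [y])
| P2_relator_scale (r s : R) x : P2_relator
    ([(r * s) *: x] - r ^+ 2 *: [s *: x] - s *: [r *: x]
      + (r ^+ 2 * s) *: [x]).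

Definition P2 : Type := quotmod P2_relator.
HB.instance Definition _ := GRing.Lmodule.on P2.

Definition P2_gen (x : M) : P2 := quotmod_pi P2_relator [x].

End P2.

Section P2Functor.
Variables (R : comPzRingType) (M M' : lmodType R) (f : {linear M' -> M}).

Let F : {linear freemod R M' -> P2 M} := free_lift (fun x => P2_gen (f x)).

Fact P2_map_relator (u : freemod R M') : P2_relator u -> F u = 0.
Proof.
have FE x : F (free_gen R x) = P2_gen (f x) by exact: free_lift_gen.
have rel0 v : P2_relator v -> quotmod_pi (@P2_relator R M) v = 0.
  move=> relv; rewrite -(linear0 (quotmod_pi _)).
  apply/eqP; rewrite quotmod_piP subr0; apply/asboolP => S _; exact.
case=> [x y z|r s x y|r s x].
- have := rel0 _ (P2_relator_add (f x) (f y) (f z)).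
  by rewrite !(linearB, linearD, linearZ) /= !FE !linearD.
- have := rel0 _ (P2_relator_cross r s (f x) (f y)).
  by rewrite !(linearB, linearD, linearZ) /= !FE !(linearD, linearZ).
- have := rel0 _ (P2_relator_scale r s (f x)).
  by rewrite !(linearB, linearD, linearZ) /= !FE !linearZ.
Qed.

Definition P2_map : P2 M' -> P2 M := quotmod_lift F.

HB.instance Definition _ := GRing.isLinear.Build R (P2 M') (P2 M) *:%R P2_map
  (quotmod_lift_is_linear P2_map_relator).

Lemma P2_map_gen x : P2_map (P2_gen x) = P2_gen (f x).
Proof.
by rewrite /P2_map /P2_gen (quotmod_lift_pi P2_map_relator); exact: free_lift_gen.
Qed.

End P2Functor.

Lemma P2_hom_ext (R : comPzRingType) (M N : lmodType R)
    (h k : {linear P2 M -> N}) :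
  (forall x, h (P2_gen x) = k (P2_gen x)) -> h = k.
Proof.
move=> hk; apply: linear_ext => q; rewrite -[q]quotmod_reprK.
rewrite -[repr q]free_lift_id; have [D uD] := freemod_supp (repr q).
rewrite (free_liftE _ uD) !linear_sum; apply: eq_bigr => x _.
by rewrite !linearZ; congr (_ *: _); exact: hk.
Qed.

Lemma P2_map_id (R : comPzRingType) (M : lmodType R) :
  P2_map (idfun : {linear M -> M}) =1 id.
Proof.
pose F : {linear P2 M -> P2 M} := P2_map (idfun : {linear M -> M}).
pose G : {linear P2 M -> P2 M} := idfun.
have FG : F = G by apply: P2_hom_ext => x; exact: P2_map_gen.
by move=> q; exact: (congr1 (fun h : {linear P2 M -> P2 M} => h q) FG).
Qed.

Lemma P2_map_comp (R : comPzRingType) (M M' M'' : lmodType R)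
    (f : {linear M' -> M}) (f' : {linear M'' -> M'}) :
  P2_map (f \o f' : {linear M'' -> M}) =1 P2_map f \o P2_map f'.
Proof.
pose F : {linear P2 M'' -> P2 M} := P2_map (f \o f' : {linear M'' -> M}).
pose G : {linear P2 M'' -> P2 M} := P2_map f \o P2_map f'.
have FG : F = G.
  by apply: P2_hom_ext => x; rewrite /= !P2_map_gen.
by move=> q; exact: (congr1 (fun h : {linear P2 M'' -> P2 M} => h q) FG).
Qed.

(* Main.v *)
Require Import Defs.
From HB Require Import structures.
From mathcomp Require Import all_boot all_order all_algebra.
From mathcomp Require Import all_classical.
Local Open Scope ring_scope.
Import GRing.Theory.

(** The three families of relators of [P2 M] are a presentation of the very
    notion of a quadratic map.  Extend a map [f : M -> N] linearly to the free
    module on [M]; its values on the relators are the obstructions to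
    additivity of the cross effect in one variable, to its homogeneity in both
    variables at once, and to homogeneity of the defects [homog_defect f r].
    The remaining axioms follow: the cross effect is symmetric, so one variable
    suffices for additivity, and the additivity obstruction of [homog_defect f r]
    is itself an instance of the homogeneity obstruction of the cross effect.
    Hence [f] is quadratic if and only if its linear extension kills all
    relators ([is_quadraticP]).

    Everything else is formal.  The linear extension of [P2_gen] is the quotient
    map, which kills the relators, so [P2_gen] is quadratic.  A quadratic map
    kills the relators, so it factors through the quotient ([P2_lift]), and
    uniquely, since [P2 M] is generated by the values of [P2_gen].  The
    isomorphism is therefore postcomposition of the universal quadratic map with
    linear maps ([P2_precomp]), and its naturality holds pointwise. *)

Section RelatorsAreDefects.
Variables (R : comPzRingType) (M N : lmodType R) (f : M -> N).

Lemma free_lift_relator_add (x y z : M) :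
  free_lift f (free_gen R (x + y + z) - free_gen R (x + y)
    - free_gen R (y + z) - free_gen R (x + z)
    + free_gen R x + free_gen R y + free_gen R z)
  = cross_effect f (x + y) z - (cross_effect f x z + cross_effect f y z).
Proof.
rewrite !(linearB, linearD) /= !free_lift_gen /cross_effect.
rewrite !opprK !addrA [RHS](ACl (1*2*7*4*5*8*9*(3*6)))%AC /=.
by rewrite addNr addr0.
Qed.

Lemma free_lift_relator_cross (r s : R) (x y : M) :
  free_lift f (free_gen R (r *: x + s *: y) - free_gen R (r *: x)
    - free_gen R (s *: y) - (r * s) *: free_gen R (x + y)
    + (r * s) *: free_gen R x + (r * s) *: free_gen R y)
  = cross_effect f (r *: x) (s *: y) - (r * s) *: cross_effect f x y.
Proof.
rewrite !(linearB, linearD, linearZ) /= !free_lift_gen /cross_effect.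
by rewrite !opprK !scalerDr !addrA.
Qed.

Lemma free_lift_relator_scale (r s : R) (x : M) :
  free_lift f (free_gen R ((r * s) *: x) - r ^+ 2 *: free_gen R (s *: x)
    - s *: free_gen R (r *: x) + (r ^+ 2 * s) *: free_gen R x)
  = homog_defect f r (s *: x) - s *: homog_defect f r x.
Proof.
rewrite !(linearB, linearD, linearZ) /= !free_lift_gen /homog_defect.
by rewrite opprK scalerDr !scalerA [s * _]mulrC scalerN addrA.
Qed.

Lemma cross_effectC (x y : M) : cross_effect f x y = cross_effect f y x.
Proof. by rewrite /cross_effect [x + y]addrC addrAC. Qed.

(** Both sides are the same signed sum of six values of [f].  The right-hand side
    vanishes as soon as the cross effect is homogeneous in both variables, which
    makes [homog_defect f r] additive. *)
Lemma homog_defectD (r : R) (x y : M) :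
  homog_defect f r (x + y) - (homog_defect f r x + homog_defect f r y)
  = cross_effect f (r *: x) (r *: y) - r ^+ 2 *: cross_effect f x y.
Proof.
rewrite /homog_defect /cross_effect scalerDr !scalerBr !opprD !opprK !addrA.
by rewrite (ACl (1*3*5*2*4*6))%AC /=.
Qed.

(** The relations impose joint bihomogeneity of the cross effect, whereas
    bilinearity concerns one variable at a time: a scalar [1] in the other
    variable passes from the first to the second, and two successive scalings
    pass back. *)
Lemma is_quadraticP :
  is_quadratic f <-> forall u, P2_relator u -> free_lift f u = 0.
Proof.
split=> [[[dl dr] hl] u|f0].
- case=> [x y z|r s x y|r s x].
  + rewrite free_lift_relator_add -{1}[x]scale1r dl scale1r; exact: subrr.
  + rewrite free_lift_relator_cross; apply/eqP; rewrite subr_eq0; apply/eqP.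
    have dZl a v w : cross_effect f (a *: v) w = a *: cross_effect f v w.
      exact: (scalable_linear (dl w) a v).
    have dZr a v w : cross_effect f v (a *: w) = a *: cross_effect f v w.
      exact: (scalable_linear (dr v) a w).
    by rewrite dZr dZl scalerA mulrC.
  + rewrite free_lift_relator_scale (scalable_linear (hl r) s); exact: subrr.
- have dD x y z :
      cross_effect f (x + y) z = cross_effect f x z + cross_effect f y z.
    apply/subr0_eq; rewrite -free_lift_relator_add; exact/f0/P2_relator_add.
  have dZ r s x y :
      cross_effect f (r *: x) (s *: y) = (r * s) *: cross_effect f x y.
    apply/subr0_eq; rewrite -free_lift_relator_cross; exact/f0/P2_relator_cross.
  have hZ r s x : homog_defect f r (s *: x) = s *: homog_defect f r x.
    apply/subr0_eq; rewrite -free_lift_relator_scale; exact/f0/P2_relator_scale.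
  have hD r x y :
      homog_defect f r (x + y) = homog_defect f r x + homog_defect f r y.
    by apply/subr0_eq; rewrite homog_defectD dZ -expr2 subrr.
  have dl z : linear (cross_effect f ^~ z).
    by move=> a x y; rewrite dD -{1}[z]scale1r dZ mulr1.
  split; first split=> // z a x y.
    by rewrite !(cross_effectC z) dl.
  by move=> r a x y; rewrite hD hZ.
Qed.

End RelatorsAreDefects.

Section Universal.
Variables (R : comPzRingType) (M : lmodType R).

Lemma free_lift_P2_gen (u : freemod R M) :
  free_lift (@P2_gen R M) u = quotmod_pi (@P2_relator R M) u.
Proof.
have [D uD] := freemod_supp u.
rewrite -[in RHS](free_lift_id u) !(free_liftE _ uD) linear_sum.
by apply: eq_bigr => x _; rewrite linearZ.
Qed.

Lemma P2_gen_quadratic : is_quadratic (@P2_gen R M).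
Proof.
apply/is_quadraticP => u relu; rewrite free_lift_P2_gen.
rewrite -(linear0 (quotmod_pi _)); apply/eqP; rewrite quotmod_piP subr0.
by apply/asboolP => S _; exact.
Qed.

Definition universal_quad : Quad M (P2 M) :=
  MkQuad (introT (quadratic_predP _) P2_gen_quadratic).

Variable N : lmodType R.

(** Precomposition of [h] with [P2_gen], written as the action of [h] on the
    universal quadratic map so that quadraticity comes from functoriality. *)
Definition P2_precomp (h : {linear P2 M -> N}) : Quad M N :=
  quad_map idfun h universal_quad.

Lemma P2_precomp_linear : linear P2_precomp.
Proof. by move=> a h k; apply: val_inj; apply/funext => x. Qed.

HB.instance Definition _ := GRing.isLinear.Build R
  {linear P2 M -> N} (Quad M N) *:%R P2_precomp P2_precomp_linear.

Section Lift.
Variable q : Quad M N.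

Let q_relator u : P2_relator u -> free_lift q u = 0.
Proof. by move: u; apply/is_quadraticP; exact: quadP. Qed.

HB.instance Definition _ := GRing.isLinear.Build R (P2 M) N *:%R
  (quotmod_lift (free_lift q)) (quotmod_lift_is_linear q_relator).

Definition P2_lift : {linear P2 M -> N} := quotmod_lift (free_lift q).

Lemma P2_lift_gen x : P2_lift (P2_gen x) = q x.
Proof. by rewrite -[RHS](free_lift_gen q); exact: quotmod_lift_pi. Qed.

End Lift.

Lemma P2_precomp_bij : bijective P2_precomp.
Proof.
exists P2_lift => [h|q].
  by apply: P2_hom_ext => x; rewrite P2_lift_gen.
by apply: val_inj; apply/funext => x; exact: P2_lift_gen.
Qed.

End Universal.

Theorem proposition1p5 (R : comPzRingType) :
  (forall M : lmodType R, is_quadratic (@P2_gen R M)) /\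
  exists Phi : forall M N : lmodType R,
      {linear {linear P2 M -> N} -> Quad M N},
    [/\ forall (M N : lmodType R) (h : {linear P2 M -> N}) (x : M),
          Phi M N h x = h (P2_gen x),
        forall M N : lmodType R, bijective (Phi M N),
        forall (M M' N : lmodType R) (f : {linear M' -> M})
            (h : {linear P2 M -> N}),
          Phi M' N (h \o P2_map f : {linear P2 M' -> N})
          = quad_map f idfun (Phi M N h)
      & forall (M N N' : lmodType R) (g : {linear N -> N'})
            (h : {linear P2 M -> N}),
          Phi M N' (g \o h : {linear P2 M -> N'})
          = quad_map idfun g (Phi M N h)].
Proof.
split=> [M|]; first exact: P2_gen_quadratic.
exists (fun M N => @P2_precomp R M N : {linear _ -> _}).
split=> [//|M N|M M' N f h|M N N' g h].
- exact: P2_precomp_bij.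
- by apply: val_inj; apply/funext => x /=; rewrite P2_map_gen.
- by apply: val_inj; apply/funext.
Qed.
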